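(* Let $K\subseteq Q$ be a convex cone, let $a\in\mathbb{R}^d$ with $a\ge 0$, let $\alpha\in\mathbb{R}$, let $r\ge 1$ be an integer, and let $I_+=\{i: a_i>0\}$. Suppose that the inequality $a^Tx\le\alpha x_0$ is valid for $K\cap\{x: x_i=x_0\text{ for all } i\in I\}$ for every set $I\subseteq I_+$ satisfying either (1) $|I|=r$, or (2) $|I|\le r-1$ and $\sum_{i\in I}a_i>\alpha$. Then $a^Tx\le\alpha x_0$ is valid for $N_+^r(K)$.
   Context: Let $d\ge 1$. Vectors in $\mathbb{R}^{d+1}$ have coordinates indexed $0,1,\dots,d$ and are written $(x_0,x)$ with $x\in\mathbb{R}^d$; $e_j$ is the $j$-th unit vector. $Q\subseteq\mathbb{R}^{d+1}$ is the convex cone generated by all vectors $(1,x)$ with $x\in\{0,1\}^d$. For a convex cone $C$, $C^*=\{s: s^Tx\ge 0\ \forall x\in C\}$. For a convex cone $K\subseteq Q$: $M_+(K)$ is the set of real symmetric positive semidefinite $(d+1)\times(d+1)$ matrices $Y$ with $Ye_0=\mathrm{diag}(Y)$ and $u^TYv\ge 0$ for all $u\in Q^*$, $v\in K^*$; $N_+(K)=\{\mathrm{diag}(Y):Y\in M_+(K)\}$; $N_+^0(K)=K$ and $N_+^r(K)=N_+(N_+^{r-1}(K))$. An inequality $a^Tx\le \alpha x_0$ is valid for a set $S\subseteq\mathbb{R}^{d+1}$ if it holds for every $(x_0,x)\in S$.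
   Formalization: The convex cone K is additionally assumed closed; without this the claim fails, e.g. d = r = 1, a = 1, α = 1/2, K = {0 ≤ x_1 < x_0} ∪ {0}, where (1,1) lies in N_+(K) but violates the inequality. *)

(* Defs.v *)
From HB Require Import structures.
From mathcomp Require Export all_boot all_order all_algebra.
From mathcomp Require Export all_classical all_reals all_analysis.
Export numFieldNormedType.Exports.

Set Implicit Arguments.
Unset Strict Implicit.
Unset Printing Implicit Defensive.

Import Order.TTheory GRing.Theory Num.Theory.

Local Open Scope classical_set_scope.
Local Open Scope ring_scope.

(* A vector (x_0, x) of R^(d+1) is y : 'cV[R]_d.+1 with x_0 = y 0 0, and the
   coordinate x_i of x, for i : 'I_d, is y (lift ord0 i) 0.  The informal index
   set {1, ..., d} is thus 'I_d. *)

Definition convex_cone (R : realType) (n : nat) (C : set 'cV[R]_n) : Prop :=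
  [/\ C 0,
      forall x y, C x -> C y -> C (x + y)
    & forall (t : R) x, 0 <= t -> C x -> C (t *: x)].

Definition dual_cone (R : realType) (n : nat) (C : set 'cV[R]_n) :
    set 'cV[R]_n :=
  [set s | forall x, C x -> 0 <= (s^T *m x) 0 0].

Definition cube_cone (R : realType) (d : nat) : set 'cV[R]_d.+1 :=
  smallest (@convex_cone R d.+1)
    [set y | y 0 0 = 1 /\
      forall i : 'I_d, y (lift ord0 i) 0 = 0 \/ y (lift ord0 i) 0 = 1].

Definition psd (R : realType) (n : nat) (Y : 'M[R]_n) : Prop :=
  Y^T = Y /\ forall x : 'cV[R]_n, 0 <= (x^T *m Y *m x) 0 0.

Definition diag_vec (R : realType) (n : nat) (Y : 'M[R]_n) : 'cV[R]_n :=
  \col_i Y i i.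

Definition Mplus (R : realType) (d : nat) (K : set 'cV[R]_d.+1) :
    set 'M[R]_d.+1 :=
  [set Y | [/\ psd Y,
               col 0 Y = diag_vec Y
             & forall u v, dual_cone (@cube_cone R d) u -> dual_cone K v ->
                 0 <= (u^T *m Y *m v) 0 0]].

Definition Nplus (R : realType) (d : nat) (K : set 'cV[R]_d.+1) :
    set 'cV[R]_d.+1 :=
  [set diag_vec Y | Y in Mplus K].

Definition Nplus_iter (R : realType) (d r : nat) (K : set 'cV[R]_d.+1) :
    set 'cV[R]_d.+1 :=
  iter r (@Nplus R d) K.

Definition valid_ineq (R : realType) (d : nat) (a : 'cV[R]_d) (alpha : R)
    (S : set 'cV[R]_d.+1) : Prop :=
  forall y, S y -> \sum_(i < d) a i 0 * y (lift ord0 i) 0 <= alpha * y 0 0.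

Definition fixed_to_one (R : realType) (d : nat) (I : {set 'I_d}) :
    set 'cV[R]_d.+1 :=
  [set y | forall i, i \in I -> y (lift ord0 i) 0 = y 0 0].

Definition pos_support (R : realType) (d : nat) (a : 'cV[R]_d) : {set 'I_d} :=
  finset (fun i => 0 < a i 0).

(* Main.v *)
(* The core is the case r = 1: if Y is in M_+(K), each column Y e_i lies in
   K (bipolar theorem) and satisfies x_i = x_0, so a^T(Y e_i) <= alpha Y_ii;
   summing with weights a_i gives a^T Y a <= alpha a^T x, while positive
   semidefiniteness gives (a^T x)^2 <= x_0 a^T Y a.  For larger r, N_+ commutes
   with intersecting with the face x_i = x_0, on which the variable x_i can be
   eliminated, turning (a, alpha) into (a with a_i := 0, alpha - a_i) and
   lowering r by one.  Applying the bipolar theorem at every level requires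
   N_+ to preserve closedness. *)
Require Import Defs.
From mathcomp Require Import lra ring.

Set Implicit Arguments.
Unset Strict Implicit.
Unset Printing Implicit Defensive.

Import Order.TTheory GRing.Theory Num.Theory.

Local Open Scope classical_set_scope.
Local Open Scope ring_scope.

(** * Continuity, closedness and compactness in matrix spaces *)

Lemma mx_continuous (T : topologicalType) (R : realType) m n
    (f : T -> 'M[R]_(m, n)) :
  (forall i j, continuous (fun x => f x i j)) -> continuous f.
Proof.
move=> fc x A [P PA sPA].
suff H : \forall z \near x, forall i j, P i j (f z i j).
  by apply: filterS H => z /sPA.
apply: filter_forall => i; apply: filter_forall => j.
exact: (fc i j x _ (PA i j)).
Qed.

Lemma continuous_sum (T : topologicalType) (R : realType) (I : Type)
    (r : seq I) (f : I -> T -> R) :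
  (forall i, continuous (f i)) -> continuous (fun x => \sum_(i <- r) f i x).
Proof.
move=> fc x; elim: r => [|i r IH].
  by under eq_fun do rewrite big_nil; exact: cst_continuous.
under eq_fun do rewrite big_cons.
by apply: cvgD; [exact: fc | exact: IH].
Qed.

(** The reshaping [vec_mx] reduces this to row vectors, where a box of closed intervals is
    compact. *)
Lemma bounded_entries_compact (R : realType) m n (A : set 'M[R]_(m, n))
    (C : R) :
  closed A -> (forall Y, A Y -> forall i j, `|Y i j| <= C) -> compact A.
Proof.
move=> Acl AC.
have vc : continuous (@vec_mx R m n).
  apply: mx_continuous => i j.
  under eq_fun do rewrite mxE.
  exact: coord_continuous.
have -> : A = @vec_mx R m n @` (@vec_mx R m n @^-1` A).
  apply/seteqP; split=> [Y AY|_ [v Av <-] //].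
  by exists (mxvec Y); rewrite /= ?mxvecK.
apply: continuous_compact; first exact: continuous_subspaceT.
have Bco : compact [set v : 'rV[R]_(m * n) | forall k, v ord0 k \in `[- C, C]].
  apply: (@rV_compact _ _ (fun=> `[- C, C]%classic)) => _.
  exact: segment_compact.
apply: subclosed_compact Bco _.
  by apply: preimage_closed => // v _; exact: vc.
move=> v /= /AC vC k; case/mxvec_indexP: k => i j.
by have := vC i j; rewrite mxE in_itv /= ler_norml.
Qed.

Lemma dotE (R : realType) n (u v : 'cV[R]_n) :
  (u^T *m v) 0 0 = \sum_i u i 0 * v i 0.
Proof. by rewrite mxE; apply: eq_bigr => i _; rewrite mxE. Qed.

Lemma bformE (R : realType) m n (u : 'cV[R]_m) (Y : 'M[R]_(m, n))
    (v : 'cV[R]_n) :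
  (u^T *m Y *m v) 0 0 = \sum_j \sum_i u i 0 * Y i j * v j 0.
Proof.
rewrite mxE; apply: eq_bigr => j _; rewrite mxE mulr_suml.
by apply: eq_bigr => i _; rewrite mxE.
Qed.

Lemma bform_continuous (R : realType) m n (u : 'cV[R]_m) (v : 'cV[R]_n) :
  continuous (fun Y : 'M[R]_(m, n) => (u^T *m Y *m v) 0 0).
Proof.
under eq_fun do rewrite bformE.
apply: continuous_sum => j; apply: continuous_sum => i Y.
apply: (@cvgM _ _ (nbhs Y) _ (fun Z => u i 0 * Z i j) (fun=> v j 0)).
  apply: (@cvgM _ _ (nbhs Y) _ (fun=> u i 0) (fun Z => Z i j)).
    exact: cvg_cst.
  exact: coord_continuous.
exact: cvg_cst.
Qed.

Lemma closed_nonneg (T : topologicalType) (R : realType) (f : T -> R) :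
  continuous f -> closed [set x | 0 <= f x].
Proof.
by move=> fc; apply: (@preimage_closed _ _ f [set z | 0 <= z]).
Qed.

Lemma closed_eqfun (T : topologicalType) (R : realType) (f g : T -> R) :
  continuous f -> continuous g -> closed [set x | f x = g x].
Proof.
move=> fc gc.
have -> : [set x | f x = g x] = [set x | f x - g x = 0].
  apply/seteqP; split=> x /= /eqP; last by rewrite subr_eq0 => /eqP.
  by rewrite -subr_eq0 => /eqP.
apply: (@preimage_closed _ _ (fun x => f x - g x) [set z | z = 0]) => [x _|].
  by apply: cvgB; [exact: fc|exact: gc].
exact: closed_eq.
Qed.

(** * Nearest points and the bipolar theorem *)

Lemma quadratic_ge0 (R : realType) (b c : R) : 0 <= c ->
  (forall t, 0 <= t <= 1 -> 0 <= 2 * t * b + t ^+ 2 * c) -> 0 <= b.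
Proof.
move=> c0 H; rewrite leNgt; apply/negP => b0.
have D0 : 0 < c + 1 - b by lra.
(* For [b < 0] this [t] lies in [(0, 1]] and makes [2 * b + t * c = b - t * (1 - b)] negative. *)
pose t := - b / (c + 1 - b).
have tD : t * (c + 1 - b) = - b by rewrite mulfVK ?gt_eqF.
have t0 : 0 < t by rewrite divr_gt0 ?oppr_gt0.
have t1 : t <= 1 by nra.
have := H t; rewrite (ltW t0) t1 => /(_ isT); nra.
Qed.

Lemma sqr_norm_eq0 (R : realType) n (v : 'cV[R]_n) :
  (v^T *m v) 0 0 <= 0 -> v = 0.
Proof.
rewrite dotE => H; apply/matrixP => i j; rewrite ord1 mxE; apply/eqP.
have /eqP : \sum_i v i 0 * v i 0 = 0.
  by apply/eqP; rewrite eq_le H sumr_ge0 // => k _; rewrite -expr2 sqr_ge0.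
rewrite psumr_eq0 => [/allP /(_ i)|k _]; last by rewrite -expr2 sqr_ge0.
by rewrite mem_index_enum => /(_ isT) /=; rewrite mulf_eq0 orbb.
Qed.

Lemma sqr_norm_ge0 (R : realType) n (v : 'cV[R]_n) : 0 <= (v^T *m v) 0 0.
Proof. by rewrite dotE sumr_ge0 // => k _; rewrite -expr2 sqr_ge0. Qed.

Lemma nearest_point (R : realType) n (K : set 'cV[R]_n) (y : 'cV[R]_n) :
  closed K -> K 0 ->
  exists2 p, K p &
    forall q, K q -> ((p - y)^T *m (p - y)) 0 0 <= ((q - y)^T *m (q - y)) 0 0.
Proof.
move=> Kcl K0; pose f p := ((p - y)^T *m (p - y)) 0 0.
have fE p : f p = \sum_i (p i 0 - y i 0) ^+ 2.
  by rewrite /f dotE; apply: eq_bigr => i _; rewrite !mxE expr2.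
have fc : continuous f.
  rewrite (funext fE : f = _); apply: continuous_sum => i p.
  apply: (@cvg_comp _ _ _ (fun z : 'cV[R]_n => z i 0 - y i 0)
    (fun t => t ^+ 2)).
    apply: (@cvgB _ _ _ (nbhs p) _ (fun z : 'cV[R]_n => z i 0) (fun=> y i 0)).
      exact: coord_continuous.
    exact: cvg_cst.
  exact: exprn_continuous.
(* [K] may be unbounded, so the minimum is taken over the points at least as close to [y] as [0]
   is. *)
pose A := K `&` [set p | 0 <= f 0 - f p].
have A0 : A 0 by split=> //=; rewrite subrr.
have Aco : compact A.
  apply: (@bounded_entries_compact _ _ _ _ (f 0 + 1 + \sum_i `|y i 0|)).
    apply: closedI => //; apply: closed_nonneg => p.
    apply: (@cvgB _ _ _ (nbhs p) _ (fun=> f 0) f); first exact: cvg_cst.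
    exact: fc.
  move=> p [_ /=]; rewrite subr_ge0 (fE p) => pf i j; rewrite ord1.
  have yi : `|y i 0| <= \sum_i `|y i 0|.
    by rewrite (bigD1 i) //= lerDl sumr_ge0.
  have pi : (p i 0 - y i 0) ^+ 2 <= f 0.
    apply: le_trans pf; rewrite (bigD1 i) //= lerDl sumr_ge0 // => k _.
    exact: sqr_ge0.
  have : `|p i 0 - y i 0| <= (p i 0 - y i 0) ^+ 2 + 1.
    by rewrite -real_normK ?num_real //; have := normr_ge0 (p i 0 - y i 0); nra.
  have := ler_normD (p i 0 - y i 0) (y i 0); rewrite subrK; lra.
have [p Ap pmin] := compact_EVT_min (ex_intro _ _ A0) Aco
  (continuous_subspaceT fc).
move: (Ap); rewrite inE => -[Kp /= fp]; exists p => // q Kq.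
rewrite -/(f p) -/(f q); case: (leP (f q) (f 0)) => [fq|]; last by lra.
by apply: pmin; rewrite inE; split=> //=; lra.
Qed.

(** If [p] is the point of [K] nearest to [y], minimality along rays puts [p - y] in the dual cone
    and makes its product with [p] nonpositive. Its product with [y] is nonnegative by hypothesis,
    so [p - y] has norm zero. *)
Lemma bipolar (R : realType) n (K : set 'cV[R]_n) (y : 'cV[R]_n) :
  convex_cone K -> closed K ->
  (forall v, dual_cone K v -> 0 <= (v^T *m y) 0 0) -> K y.
Proof.
move=> [K0 KD KZ] Kcl H.
have [p Kp pmin] := nearest_point y Kcl K0.
have expand t k : K (p + t *: k) ->
    0 <= 2 * t * ((p - y)^T *m k) 0 0 + t ^+ 2 * (k^T *m k) 0 0.
  move=> /pmin; rewrite !dotE -subr_ge0 -sumrB !mulr_sumr -big_split /=.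
  congr (_ <= _); apply: eq_bigr => i _; rewrite !mxE; ring.
have dual : dual_cone K (p - y).
  move=> k Kk; apply: quadratic_ge0 (sqr_norm_ge0 k) _ => t /andP[t0 _].
  by apply: expand; apply: KD => //; exact: KZ.
(* Moving from [p] to [(1 - t) *: p] stays in the cone only for [t <= 1], whence the range of [t] in
   [quadratic_ge0]. *)
have pp : ((p - y)^T *m p) 0 0 <= 0.
  rewrite -oppr_ge0; apply: quadratic_ge0 (sqr_norm_ge0 p) _ => t /andP[_ t1].
  have := @expand (- t) p; rewrite mulrN mulNr sqrrN mulrN; apply.
  by rewrite -[X in X + _]scale1r -scalerDl; apply: KZ => //; lra.
suff /eqP : p - y = 0 by rewrite subr_eq0 => /eqP <-.
apply: sqr_norm_eq0; have := H _ dual.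
rewrite [X in _ -> X <= 0](_ : _ = ((p - y)^T *m p) 0 0 - ((p - y)^T *m y) 0 0).
  by lra.
by rewrite mulmxBr !mxE.
Qed.

(** * Positive semidefinite forms, and coordinates on the cube cone *)

Lemma bform_sym (R : realType) n (Y : 'M[R]_n) (u v : 'cV[R]_n) :
  Y^T = Y -> (u^T *m Y *m v) 0 0 = (v^T *m Y *m u) 0 0.
Proof.
move=> Ysym; have -> : (u^T *m Y *m v) 0 0 = (u^T *m Y *m v)^T 0 0.
  by rewrite [RHS]mxE.
by rewrite !trmx_mul trmxK Ysym mulmxA.
Qed.

Lemma psd_cauchy_schwarz (R : realType) n (Y : 'M[R]_n) (u v : 'cV[R]_n) :
  psd Y -> (u^T *m Y *m v) 0 0 ^+ 2 <=
    (u^T *m Y *m u) 0 0 * (v^T *m Y *m v) 0 0.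
Proof.
move=> [Ysym Ypos].
set A := (u^T *m Y *m u) 0 0; set B := (u^T *m Y *m v) 0 0.
set C := (v^T *m Y *m v) 0 0.
have A0 : 0 <= A by exact: Ypos.
have C0 : 0 <= C by exact: Ypos.
have H s t : 0 <= s ^+ 2 * A + 2 * s * t * B + t ^+ 2 * C.
  have := Ypos (s *: u + t *: v).
  have -> : (s *: u + t *: v)^T = s *: u^T + t *: v^T.
    by apply/matrixP => i j; rewrite !mxE.
  rewrite !(mulmxDl, mulmxDr) -!(scalemxAl, scalemxAr) !scalerA.
  have mxDZ (M N P Q : 'M[R]_1) x y z w :
    (x *: M + y *: N + (z *: P + w *: Q)) 0 0 =
    x * M 0 0 + y * N 0 0 + (z * P 0 0 + w * Q 0 0) by rewrite !mxE.
  rewrite mxDZ.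
  rewrite -/A -/B -/C (bform_sym v u Ysym) -/B.
  by congr (_ <= _); ring.
have [C1|/eqP C1] := eqVneq C 0; last first.
  have : 0 < C by rewrite lt_neqAle eq_sym C0 andbT; apply/eqP.
  (* This choice yields [C * (A * C - B ^+ 2) >= 0]. *)
  by have := H C (- B); nra.
have [->|B0] := eqVneq B 0; first by rewrite expr0n /= mulr_ge0.
(* With [C = 0] and [B != 0] the form is affine in [t]; this [t] gives it the value [-1]. *)
have := H 1 (- (A + 1) / (2 * B)); rewrite C1.
have -> : 1 ^+ 2 * A + 2 * 1 * (- (A + 1) / (2 * B)) * B +
   (- (A + 1) / (2 * B)) ^+ 2 * 0 = - 1 by field.
by lra.
Qed.

Lemma delta_mulmx_bform (R : realType) m n (Y : 'M[R]_(m, n)) i (v : 'cV[R]_n) :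
  ((delta_mx i 0 : 'cV[R]_m)^T *m Y *m v) 0 0 = (Y *m v) i 0.
Proof. by rewrite trmx_delta -mulmxA -rowE mxE. Qed.

Lemma bform_delta (R : realType) m n (Y : 'M[R]_(m, n)) i j :
  ((delta_mx i 0 : 'cV[R]_m)^T *m Y *m (delta_mx j 0 : 'cV[R]_n)) 0 0 = Y i j.
Proof. by rewrite delta_mulmx_bform -colE mxE. Qed.

(** Cauchy-Schwarz against each unit vector kills every coordinate of [Y *m u]. *)
Lemma psd_kernel (R : realType) n (Y : 'M[R]_n) (u : 'cV[R]_n) :
  psd Y -> (u^T *m Y *m u) 0 0 = 0 -> Y *m u = 0.
Proof.
move=> Ypsd u0; apply/matrixP => i j; rewrite ord1 [RHS]mxE -delta_mulmx_bform.
have := psd_cauchy_schwarz (delta_mx i 0) u Ypsd; rewrite u0 mulr0 => H.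
by apply/eqP; rewrite -sqrf_eq0 eq_le H sqr_ge0.
Qed.

(** This admits unit vectors as [u] in [Mplus], which is how columns of [Y] come to lie in [K]. *)
Lemma cube_cone_nonneg (R : realType) d i :
  dual_cone (@cube_cone R d) (delta_mx i 0).
Proof.
move=> x; have -> : ((delta_mx i 0 : 'cV[R]_d.+1)^T *m x) 0 0 = x i 0.
  by rewrite trmx_delta -rowE mxE.
suff : @cube_cone R d `<=` [set x | 0 <= x i 0] by apply.
apply: smallest_sub.
  by split=> [|y z /= y0 z0|t y t0 /= y0]; rewrite /= mxE ?addr_ge0 ?mulr_ge0.
move=> y [y0 y01] /=; case: (unliftP ord0 i) => [j|] ->; last by rewrite y0.
by case: (y01 j) => ->.
Qed.

(** * The operators [Mplus] and [Nplus] *)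

Section Mplus_facts.
Variables (R : realType) (d : nat).
Implicit Types (K : set 'cV[R]_d.+1) (Y : 'M[R]_d.+1).

(** Nonnegativity against all of the dual of [K] says that [Y *m u] lies in the bidual, which is [K]
    because [K] is a closed convex cone. *)
Lemma MplusP K Y : convex_cone K -> closed K ->
  Mplus K Y <-> [/\ psd Y, col 0 Y = diag_vec Y &
    forall u, dual_cone (@cube_cone R d) u -> K (Y *m u)].
Proof.
move=> Kcone Kcl; split=> -[Ypsd Ydiag YK]; split=> // u.
  move=> Qu; apply: bipolar => // v Kv.
  by rewrite mulmxA bform_sym ?(proj1 Ypsd) //; exact: YK.
move=> v /YK Ku Kv; rewrite bform_sym ?(proj1 Ypsd) // -mulmxA; exact: Kv.
Qed.

Lemma Mplus_mono K1 K2 : K1 `<=` K2 -> Mplus K1 `<=` Mplus K2.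
Proof.
move=> K12 Y [Ypsd Ydiag YK]; split=> // u v Qu K2v; apply: YK => // x /K12.
exact: K2v.
Qed.

Lemma Nplus_mono K1 K2 : K1 `<=` K2 -> Nplus K1 `<=` Nplus K2.
Proof. by move=> K12 _ [Y /(Mplus_mono K12) YK <-]; exists Y. Qed.

Lemma Mplus_col K Y j : convex_cone K -> closed K -> Mplus K Y -> K (col j Y).
Proof.
move=> Kcone Kcl /(MplusP _ Kcone Kcl)[_ _ YK].
by rewrite colE; apply: YK; exact: cube_cone_nonneg.
Qed.

Lemma Nplus_sub K : convex_cone K -> closed K -> Nplus K `<=` K.
Proof.
move=> Kcone Kcl _ [Y YK <-]; have [_ <- _] := YK; exact: Mplus_col.
Qed.

Lemma Mplus_diag0 K Y i : Mplus K Y -> Y i 0 = Y i i.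
Proof. by move=> [_ /matrixP /(_ i 0)]; rewrite !mxE. Qed.

(** The 2 by 2 minors are nonnegative. With [Y k 0 = Y k k], the minor on [k] and [0] bounds the
    diagonal by [Y 0 0]; the minor on [i] and [j] then bounds the other entries. *)
Lemma Mplus_bound K Y i j : Mplus K Y -> `|Y i j| <= Y 0 0.
Proof.
move=> YK; have [Ypsd _ _] := YK.
have CS k l : Y k l ^+ 2 <= Y k k * Y l l.
  have := psd_cauchy_schwarz (delta_mx k 0) (delta_mx l 0) Ypsd.
  by rewrite !bform_delta.
have Y0 k : 0 <= Y k k by rewrite -bform_delta; exact: (proj2 Ypsd).
have Yk k : Y k k <= Y 0 0.
  have := CS k 0; rewrite (Mplus_diag0 k YK) => H.
  have := Y0 k; have := Y0 0; nra.
rewrite -(@ler_pXn2r _ 2) ?nnegrE // real_normK ?num_real //.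
by apply: le_trans (CS i j) _; rewrite expr2 ler_pM.
Qed.

Lemma Nplus_convex_cone K : convex_cone (Nplus K).
Proof.
split.
- exists 0; last by apply/matrixP => i j; rewrite !mxE.
  split; [split|..].
  + by rewrite trmx0.
  + by move=> x; rewrite mulmx0 mul0mx mxE.
  + by apply/matrixP => i j; rewrite !mxE.
  + by move=> u v _ _; rewrite mulmx0 mul0mx mxE.
- move=> _ _ [Y [[Ys Yp] Yd YK] <-] [Z [[Zs Zp] Zd ZK] <-].
  exists (Y + Z); last by apply/matrixP => i j; rewrite !mxE.
  split; [split|..].
  + by rewrite linearD /= Ys Zs.
  + by move=> x; rewrite mulmxDr mulmxDl mxE addr_ge0.
  + move/matrixP: Yd => Yd; move/matrixP: Zd => Zd.
    apply/matrixP => i j; have := Yd i j; have := Zd i j.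
    by rewrite !mxE => -> ->.
  + by move=> u v Qu Kv; rewrite mulmxDr mulmxDl mxE addr_ge0 ?YK ?ZK.
- move=> t _ t0 [Y [[Ys Yp] Yd YK] <-].
  exists (t *: Y); last by apply/matrixP => i j; rewrite !mxE.
  split; [split|..].
  + by rewrite linearZ /= Ys.
  + by move=> x; rewrite -scalemxAr -scalemxAl mxE mulr_ge0.
  + move/matrixP: Yd => Yd.
    by apply/matrixP => i j; have := Yd i j; rewrite !mxE => ->.
  + by move=> u v Qu Kv; rewrite -scalemxAr -scalemxAl mxE mulr_ge0 ?YK.
Qed.

Lemma closed_Mplus K : closed (Mplus K).
Proof.
have -> : Mplus K =
  (\bigcap_(k in [set: 'I_d.+1 * 'I_d.+1])
     [set Y : 'M[R]_d.+1 | Y k.1 k.2 = Y k.2 k.1]) `&`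
  (\bigcap_(x in [set: 'cV[R]_d.+1])
     [set Y : 'M[R]_d.+1 | 0 <= (x^T *m Y *m x) 0 0]) `&`
  (\bigcap_(i in [set: 'I_d.+1]) [set Y : 'M[R]_d.+1 | Y i 0 = Y i i]) `&`
  (\bigcap_(w in dual_cone (@cube_cone R d) `*` dual_cone K)
     [set Y : 'M[R]_d.+1 | 0 <= (w.1^T *m Y *m w.2) 0 0]).
  apply/seteqP; split=> Y.
    move=> YK; have [[Ys Yp] Yd H] := YK; split; [split; [split|]|].
    - by move=> [i j] _ /=; rewrite -[in LHS]Ys mxE.
    - by move=> x _; exact: Yp.
    - by move=> i _; exact: Mplus_diag0 YK.
    - by move=> [u v] [/= Qu Kv]; exact: H.
  move=> [[[Ys Yp] Yd] H]; split; [split|..].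
  - by apply/matrixP => i j; rewrite mxE; exact: (Ys (j, i) I).
  - by move=> x; exact: Yp.
  - by apply/matrixP => i j; rewrite !mxE; exact: Yd.
  - by move=> u v Qu Kv; exact: (H (u, v)).
apply: closedI; first apply: closedI; first apply: closedI.
- by apply: closed_bigI => k _; apply: closed_eqfun; exact: coord_continuous.
- by apply: closed_bigI => x _; apply: closed_nonneg; exact: bform_continuous.
- by apply: closed_bigI => k _; apply: closed_eqfun; exact: coord_continuous.
- by apply: closed_bigI => x _; apply: closed_nonneg; exact: bform_continuous.
Qed.

(* By [Mplus_bound], the matrices whose diagonal lies near a given vector
   form a compact set. *)
Lemma closed_Nplus K : closed (Nplus K).
Proof.
move=> y ycl.
(* The slack [1] makes [z 0 0 < C] a neighbourhood of [y], so nearby points of [Nplus K] come from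
   matrices in [A]. *)
pose C := y 0 0 + 1.
pose A := Mplus K `&` [set Y : 'M[R]_d.+1 | 0 <= C - Y 0 0].
have Cc m n (i : 'I_m) (j : 'I_n) :
    continuous (fun Y : 'M[R]_(m, n) => C - Y i j).
  move=> Y; apply: (@cvgB _ _ _ (nbhs Y) _ (fun=> C) (fun Z => Z i j)).
    exact: cvg_cst.
  exact: coord_continuous.
have Aco : compact A.
  apply: (@bounded_entries_compact _ _ _ _ C).
    by apply: closedI; [exact: closed_Mplus | apply: closed_nonneg; exact: Cc].
  move=> Y [YK /=]; rewrite subr_ge0 => YC i j.
  exact: le_trans (Mplus_bound i j YK) YC.
have dc : continuous (@diag_vec R d.+1).
  apply: mx_continuous => i j; under eq_fun do rewrite mxE.
  exact: coord_continuous.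
have dAcl : closed (@diag_vec R d.+1 @` A).
  apply: compact_closed; first exact: norm_hausdorff.
  by apply: continuous_compact => //; exact: continuous_subspaceT.
suff [Y [YK _] <-] : (@diag_vec R d.+1 @` A) y by exists Y.
apply: dAcl => U Uy.
have Vy : nbhs y (U `&` [set z : 'cV[R]_d.+1 | 0 < C - z 0 0]).
  apply: filterI => //; apply: (Cc _ _ 0 0 y [set t | 0 < t]).
  apply: open_nbhs_nbhs; split; first exact: open_gt.
  by rewrite /= /C; lra.
have [_ [[Y YK <-] [UY /= YC]]] := ycl _ Vy.
exists (diag_vec Y); split=> //; exists Y => //; split=> //=.
by move: YC; rewrite mxE => /ltW.
Qed.

Lemma Nplus_iter_cone K r : convex_cone K -> closed K ->
  convex_cone (Nplus_iter r K) /\ closed (Nplus_iter r K).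
Proof.
move=> Kcone Kcl; case: r => [//|r].
by split; [exact: Nplus_convex_cone | exact: closed_Nplus].
Qed.

Lemma Nplus_iter_sub K r : convex_cone K -> closed K -> Nplus_iter r K `<=` K.
Proof.
move=> Kcone Kcl; elim: r => [//|r IH].
have [rcone rcl] := Nplus_iter_cone r Kcone Kcl.
exact: subset_trans (Nplus_sub rcone rcl) IH.
Qed.

(** * Faces on which [x_i = x_0] *)

Lemma fixed_convex_cone (I : {set 'I_d}) : convex_cone (@fixed_to_one R d I).
Proof.
split=> [i _|x y Fx Fy i iI|t x _ Fx i iI]; rewrite !mxE //.
  by rewrite Fx // Fy.
by rewrite Fx.
Qed.

Lemma closed_fixed (I : {set 'I_d}) : closed (@fixed_to_one R d I).
Proof.
have -> : @fixed_to_one R d I = \bigcap_(i in [set i | i \in I])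
    [set y : 'cV[R]_d.+1 | y (lift ord0 i) 0 = y 0 0].
  by apply/seteqP; split=> y Hy i iI; exact: Hy.
by apply: closed_bigI => k _; apply: closed_eqfun; exact: coord_continuous.
Qed.

Lemma convex_coneI K1 K2 :
  convex_cone K1 -> convex_cone K2 -> convex_cone (K1 `&` K2).
Proof.
move=> [Z1 D1 S1] [Z2 D2 S2]; split=> [//|x y [? ?] [? ?]|t x t0 [? ?]].
  by split; [exact: D1 | exact: D2].
by split; [exact: S1 | exact: S2].
Qed.

(* If [x_i = x_0] then [e_0 - e_i] is isotropic for [Y], hence in its kernel. *)
Lemma Nplus_face K i : convex_cone K -> closed K ->
  Nplus K `&` @fixed_to_one R d [set i] `<=`
  Nplus (K `&` @fixed_to_one R d [set i]).
Proof.
move=> Kcone Kcl _ [[Y YK <-] Fy]; exists Y => //.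
have [Ypsd Yd YQ] := (MplusP Y Kcone Kcl).1 YK.
have [Ysym _] := Ypsd.
apply/MplusP.
- by apply: convex_coneI => //; exact: fixed_convex_cone.
- by apply: closedI => //; exact: closed_fixed.
split=> // u Qu; split; first exact: YQ.
move=> k; rewrite inE => /eqP -> {k}.
set l := lift ord0 i.
have Yll : Y l l = Y 0 0 by have := Fy i; rewrite inE eqxx !mxE => /(_ isT).
have Yl0 : Y l 0 = Y 0 0 by rewrite (Mplus_diag0 l YK).
have Y0l : Y 0 l = Y 0 0 by rewrite -[in LHS]Ysym mxE.
pose e : 'cV[R]_d.+1 := delta_mx l 0 - delta_mx 0 0.
have eT : e^T = (delta_mx l 0)^T - (delta_mx 0 0)^T.
  by apply/matrixP => p q; rewrite !mxE.
have sub00 (M N : 'M[R]_1) : (M - N) 0 0 = M 0 0 - N 0 0 by rewrite !mxE.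
have ker : Y *m e = 0.
  apply: psd_kernel => //; rewrite eT /e !(mulmxBl, mulmxBr) !sub00.
  by rewrite !bform_delta Yll Yl0 Y0l; lra.
(* The difference of the two coordinates of [Y *m u] is [e^T Y u], which equals [u^T Y e = 0] by
   symmetry. *)
rewrite -(delta_mulmx_bform Y l u) -(delta_mulmx_bform Y 0 u).
apply/eqP; rewrite -subr_eq0 -sub00 -!mulmxBl -eT (bform_sym e u Ysym).
by rewrite -mulmxA ker mulmx0 mxE.
Qed.

Lemma Nplus_iter_face K i r : convex_cone K -> closed K ->
  Nplus_iter r K `&` @fixed_to_one R d [set i] `<=`
  Nplus_iter r (K `&` @fixed_to_one R d [set i]).
Proof.
move=> Kcone Kcl; elim: r => [//|r IH].
have [rcone rcl] := Nplus_iter_cone r Kcone Kcl.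
exact: subset_trans (Nplus_face rcone rcl) (Nplus_mono IH).
Qed.

(** * Validity after one and after several applications of [Nplus] *)

Lemma Nplus_valid (a : 'cV[R]_d) (alpha : R) K :
  convex_cone K -> closed K -> (forall i, 0 <= a i 0) -> 0 <= alpha ->
  (forall i, 0 < a i 0 ->
    valid_ineq a alpha (K `&` @fixed_to_one R d [set i])) ->
  valid_ineq a alpha (Nplus K).
Proof.
move=> Kcone Kcl a0 alpha0 H _ [Y YK <-].
have [Ypsd _ _] := YK; have [Ysym _] := Ypsd.
have colY i : a i 0 * \sum_(k < d) a k 0 * Y (lift ord0 k) (lift ord0 i) <=
    alpha * (a i 0 * Y 0 (lift ord0 i)).
  have [ai0|ai] := eqVneq (a i 0) 0; first by rewrite ai0 !mul0r mulr0.
  have {}ai : 0 < a i 0 by rewrite lt_neqAle eq_sym ai a0.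
  rewrite mulrCA ler_pM2l //.
  have := H i ai (col (lift ord0 i) Y); rewrite mxE.
  under eq_bigr do rewrite mxE.
  apply; split; first exact: Mplus_col.
  move=> j; rewrite inE => /eqP ->; rewrite !mxE.
  by rewrite -(Mplus_diag0 _ YK) -[in LHS]Ysym mxE.
(* Padding [a] with [0] in coordinate 0 makes [w^T Y w] equal to [a^T Y a] and [e_0^T Y w] equal to
   [a^T x]. *)
pose w : 'cV[R]_d.+1 :=
  \col_i (if unlift ord0 i is Some k then a k 0 else 0).
have w0 : w 0 0 = 0 by rewrite mxE unlift_none.
have wl k : w (lift ord0 k) 0 = a k 0 by rewrite mxE liftK.
pose s := \sum_(i < d) a i 0 * Y 0 (lift ord0 i).
have Yw k : (Y *m w) k 0 = \sum_(i < d) a i 0 * Y k (lift ord0 i).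
  rewrite mxE big_ord_recl w0 mulr0 add0r; apply: eq_bigr => i _.
  by rewrite wl mulrC.
have ww : (w^T *m Y *m w) 0 0 <= alpha * s.
  rewrite -mulmxA dotE big_ord_recl w0 mul0r add0r mulr_sumr.
  apply: ler_sum => i _; rewrite wl Yw; apply: le_trans (colY i).
  rewrite ler_wpM2l //; apply: ler_sum => k _.
  by rewrite -[in leLHS]Ysym mxE.
have CS := psd_cauchy_schwarz (delta_mx 0 0) w Ypsd.
rewrite bform_delta delta_mulmx_bform Yw -/s in CS.
have Y00 : 0 <= Y 0 0 by rewrite -bform_delta; exact: (proj2 Ypsd).
have -> : \sum_(i < d) a i 0 * diag_vec Y (lift ord0 i) 0 = s.
  apply: eq_bigr => i _; rewrite mxE -(Mplus_diag0 _ YK).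
  by rewrite -[in LHS]Ysym mxE.
(* The bounds combine to [s ^+ 2 <= alpha * Y 0 0 * s]; as [alpha * Y 0 0] is nonnegative, [s]
   cannot exceed it. *)
rewrite mxE; have : 0 <= alpha * Y 0 0 by rewrite mulr_ge0.
by move: CS ww; nra.
Qed.

End Mplus_facts.

(** Writing condition (2) with [#|I| < r] lets the induction start at [r = 0], where the empty set
    gives the claim. The induction varies [a], [alpha] and [K], since passing to a face changes all
    three. *)
Lemma Nplus_iter_valid (R : realType) d (r : nat) (a : 'cV[R]_d) (alpha : R)
    (K : set 'cV[R]_d.+1) :
  convex_cone K -> closed K -> (forall i, 0 <= a i 0) ->
  (forall I : {set 'I_d}, I \subset pos_support a ->
     #|I| = r \/ ((#|I| < r)%N /\ alpha < \sum_(i in I) a i 0) ->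
     valid_ineq a alpha (K `&` @fixed_to_one R d I)) ->
  valid_ineq a alpha (Nplus_iter r K).
Proof.
elim: r a alpha K => [|r IH] a alpha K Kcone Kcl a0 H.
  move=> y Ky; apply: (H finset.set0 _ _ y); rewrite ?finset.sub0set ?cards0 //.
    by left.
  by split=> // i; rewrite inE.
(* For negative [alpha] the empty set meets condition (2), so the inequality already holds on [K].
   The other case supplies the sign needed by [Nplus_valid]. *)
have [alpha0|alpha0] := ltP alpha 0.
  move=> y /(Nplus_iter_sub Kcone Kcl) Ky.
  apply: (H finset.set0 _ _ y); rewrite ?finset.sub0set ?cards0 ?big_set0 //.
    by right.
  by split=> // i; rewrite inE.
have [rcone rcl] := Nplus_iter_cone r Kcone Kcl.
apply: Nplus_valid => // i ai y Hy.
have Fy := proj2 Hy; have {}Hy := Nplus_iter_face Kcone Kcl Hy.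
pose a' : 'cV[R]_d := \col_j (if j == i then 0 else a j 0).
(* On the face [x_i = x_0] the inequality reads
   [a'^T x <= (alpha - a_i) x_0]. *)
have reduce z : @fixed_to_one R d [set i] z ->
    \sum_(j < d) a j 0 * z (lift ord0 j) 0 - alpha * z 0 0 =
    \sum_(j < d) a' j 0 * z (lift ord0 j) 0 - (alpha - a i 0) * z 0 0.
  move=> /(_ i); rewrite inE eqxx => /(_ isT) zi.
  rewrite (bigD1 i) //= [in RHS](bigD1 i) //= zi mxE eqxx mul0r add0r.
  under [in RHS]eq_bigr => j ji do rewrite mxE (negbTE ji).
  by ring.
rewrite -subr_le0 reduce // subr_le0; apply: IH Hy.
- by apply: convex_coneI => //; exact: fixed_convex_cone.
- by apply: closedI => //; exact: closed_fixed.
- by move=> j; rewrite mxE; case: ifP.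
move=> J Ja' HJ z [[Kz Fz] FJz].
have iJ : i \notin J.
  by apply/negP => /(fintype.subsetP Ja'); rewrite inE mxE eqxx ltxx.
(* Adding [i] to [J] raises the size by one and the weight by [a i 0], matching the shifts from [r]
   to [r.+1] and from [alpha - a i 0] to [alpha]. *)
rewrite -subr_le0 -reduce // subr_le0; apply: (H (i |: J) _ _ z).
- apply/fintype.subsetP => j.
  case/finset.setU1P => [->|/(fintype.subsetP Ja')].
    by rewrite inE.
  by rewrite !inE mxE; case: ifP => //; rewrite ltxx.
- rewrite cardsU1 iJ add1n big_setU1 //= ltnS.
  case: HJ => [->|[Jr Ja]]; [by left | right; split=> //].
  rewrite -ltrBlDl (eq_bigr (fun j => a' j 0)) // => j jJ.
  by rewrite mxE; case: eqP => // ji; rewrite ji (negbTE iJ) in jJ.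
- by split=> // j /finset.setU1P[->|]; [apply: Fz; rewrite inE | exact: FJz].
Qed.

(* Closedness of K is needed: for d = 1, r = 1, a = 1, alpha = 1/2, the cone
   K = {(x_0, x_1) : 0 <= x_1 < x_0} together with 0 satisfies all the other
   hypotheses, but N_+(K) depends only on the closure of K and contains
   (1, 1). *)
Theorem theorem3p6 (R : realType) (d : nat) (hd : (1 <= d)%N)
  (K : set 'cV[R]_d.+1) (hK : convex_cone K) (hKclosed : closed K)
  (hKQ : K `<=` @cube_cone R d)
  (a : 'cV[R]_d) (ha : forall i, 0 <= a i 0)
  (alpha : R) (r : nat) (hr : (1 <= r)%N)
  (hvalid : forall I : {set 'I_d}, I \subset pos_support a ->
     #|I| = r \/ ((#|I| <= r - 1)%N /\ alpha < \sum_(i in I) a i 0) ->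
     valid_ineq a alpha (K `&` @fixed_to_one R d I)) :
  valid_ineq a alpha (Nplus_iter r K).
Proof.
apply: Nplus_iter_valid => // I Isub HI; apply: hvalid => //.
case: HI => [?|[? ?]]; [by left | right; split=> //].
(* Subtraction on naturals is truncated; [1 <= r] turns [#|I| < r] into [#|I| <= r - 1]. *)
by rewrite subn1 -ltnS prednK.
Qed.
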